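(* Let $t\geq 2$ and $c\geq 3$ be any integers. Then there exists a graph $G$ such that $\alpha(G)=t$, $\chi(G)=c$ and $${\rm b}(G)=\frac{(t-1)|V(G)|+t\chi(G)}{2t-1}.$$
   Context: All graphs are finite, undirected, without loops or multiple edges. $\chi(G)$ is the chromatic number and $\alpha(G)$ the maximum size of an independent set of $G$. Let $f$ be a proper vertex coloring of $G$ using $k$ colors (every one of the $k$ colors is used). A vertex $u$ is a b-vertex (of $f$) if for each color $j\neq f(u)$, $u$ has a neighbor of color $j$. The coloring $f$ is a b-coloring if every color class contains a b-vertex. The b-chromatic number ${\rm b}(G)$ is the maximum number of colors used in a b-coloring of $G$. *)

(* Defs.v *)
From mathcomp Require Import all_boot all_order all_algebra.

Set Implicit Arguments.
Unset Strict Implicit.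
Unset Printing Implicit Defensive.

Record sgraph := SGraph {
  vertex :> finType;
  adj : rel vertex;
  adj_sym : symmetric adj;
  adj_irrefl : irreflexive adj }.

Section Colorings.

Variable G : sgraph.

Definition independent (S : {set G}) : bool :=
  [forall u in S, forall v in S, ~~ adj u v].

Definition independence_number : nat :=
  \max_(S : {set G} | independent S) #|S|.

Definition proper_coloring (k : nat) (f : {ffun G -> 'I_k}) : bool :=
  [forall u, forall v, adj u v ==> (f u != f v)].

Definition colorable (k : nat) : bool :=
  [exists f : {ffun G -> 'I_k}, proper_coloring f].

Lemma colorable_exists : exists k, colorable k.
Proof.
exists #|G|; apply/existsP; exists [ffun u => enum_rank u].
apply/forallP=> u; apply/forallP=> v; apply/implyP=> uv; rewrite !ffunE.
by apply/eqP=> /enum_rank_inj eq_uv; rewrite eq_uv adj_irrefl in uv.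
Qed.

Definition chromatic_number : nat := ex_minn colorable_exists.

Definition b_vertex (k : nat) (f : {ffun G -> 'I_k}) (u : G) : bool :=
  [forall j : 'I_k, (j != f u) ==> [exists v, adj u v && (f v == j)]].

(* The second conjunct forces f to be onto: all k colors are used. *)
Definition b_coloring (k : nat) (f : {ffun G -> 'I_k}) : bool :=
  proper_coloring f && [forall j : 'I_k, exists u, (f u == j) && b_vertex f u].

Definition b_colorable (k : nat) : bool :=
  [exists f : {ffun G -> 'I_k}, b_coloring f].

Lemma b_colorable_leq_card k : b_colorable k -> k <= #|G|.
Proof.
case/existsP=> f /andP[_ /forallP f_onto].
have -> : k = #|codom f|.
  rewrite -[LHS]card_ord; apply/esym/eq_card => j.
  by have /existsP[u /andP[/eqP <- _]] := f_onto j; rewrite codom_f.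
exact: leq_image_card.
Qed.

(* By b_colorable_leq_card, bounding k by #|G| loses no b-coloring. *)
Definition b_chromatic_number : nat :=
  \max_(k < #|G|.+1 | b_colorable k) k.

End Colorings.

(* Main.v *)
(** In a b-coloring with k colors the b-vertices meet all k classes, and each of
them has degree at least k - 1; so b(G) is bounded as soon as few vertices have
large degree.  Equality is reached on the following graph.  Take independent
u_0, ..., u_(t-1) and v_0, ..., v_(t-1), with u_i ~ v_j iff i <> j, and a clique
k_0, ..., k_(c-2) completely joined to the u_i; join moreover v_0 to every k_l
with l <> 0, and v_1 to k_0.  The coloring with classes {u_i, v_i} and {k_l} is a
b-coloring with t + c - 1 colors, and this is optimal because all u_i and v_i
have degree at most t + c - 2.  The last edges keep {v_i} u {k_l} from being
independent: they allow t cliques to cover the graph. *)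
Require Import Defs.
From mathcomp Require Import all_boot all_order all_algebra.
From mathcomp Require Import ring zify.

(** * General bounds on the three graph parameters *)

Lemma proper_coloringP (G : sgraph) k (f : {ffun G -> 'I_k}) :
  reflect (forall u v, adj u v -> f u != f v) (proper_coloring f).
Proof.
apply: (iffP forallP) => [fP u v uv|fP u].
  by have /forallP/(_ v)/implyP := fP u; apply.
by apply/forallP=> v; apply/implyP; apply: fP.
Qed.

Lemma independentP (G : sgraph) (S : {set G}) :
  reflect {in S &, forall u v, ~~ adj u v} (independent S).
Proof.
apply: (iffP forall_inP) => [SP u v uS vS|SP u uS].
  by have /forall_inP := SP u uS; apply.
by apply/forall_inP=> v vS; apply: SP.
Qed.

(** The fibres of [q] are cliques, so [q] is injective on every independent set. *)
Lemma independence_number_clique_cover (G : sgraph) (T : finType) (q : G -> T) :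
    (forall x y, q x = q y -> x != y -> adj x y) ->
  independence_number G <= #|T|.
Proof.
move=> qP; apply/bigmax_leqP=> S /independentP indS.
rewrite -(card_in_imset (f := q)) ?max_card // => x y xS yS qxy.
by apply/eqP; apply: contraTT (indS x y xS yS) => /(qP x y qxy) ->.
Qed.

Lemma chromatic_number_clique (G : sgraph) (T : finType) (g : T -> G) :
    (forall x y, x != y -> adj (g x) (g y)) ->
  #|T| <= chromatic_number G.
Proof.
move=> gP; rewrite /chromatic_number; case: ex_minnP => k /existsP[f fP] _.
have /leq_card : injective (f \o g).
  move=> x y /eqP; apply: contraTeq => /gP.
  by move/proper_coloringP: fP; apply.
by rewrite card_ord.
Qed.

Lemma chromatic_number_leq (G : sgraph) k : colorable G k -> chromatic_number G <= k.
Proof. by rewrite /chromatic_number; case: ex_minnP => n _; apply. Qed.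

(** The neighbours of [u] show every colour other than [f u]. *)
Lemma b_vertex_degree (G : sgraph) k (f : {ffun G -> 'I_k}) u :
  b_vertex f u -> k <= #|adj u|.+1.
Proof.
move=> /forallP uP; rewrite -[k in k <= _]card_ord -cardsT.
have /subset_leq_card : [set: 'I_k] \subset f u |: f @: [set v | adj u v].
  apply/subsetP=> j _; rewrite !inE; case: eqP => //= /eqP ju.
  have /existsP[v /andP[uv /eqP <-]] := implyP (uP j) ju.
  by apply: imset_f; rewrite inE.
move/leq_trans; apply; rewrite cardsU1 -add1n leq_add ?leq_b1 //.
by apply: leq_trans (leq_imset_card _ _) _; rewrite cardsE.
Qed.

(** Each colour is attained at a b-vertex, whose degree is at least [k - 1]; hence [f] maps the
    vertices of such degree onto all [k] colours. *)
Lemma b_colorable_degree (G : sgraph) k :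
  b_colorable G k -> k <= #|[set u : G | k <= #|adj u|.+1]|.
Proof.
case/existsP=> f /andP[_ /forallP bP].
rewrite -[k in k <= _]card_ord -cardsT.
apply: leq_trans (leq_imset_card f _); apply/subset_leq_card/subsetP => j _.
have /existsP[u /andP[/eqP <- ub]] := bP j.
by apply: imset_f; rewrite inE; apply: b_vertex_degree ub.
Qed.

Lemma leq_b_chromatic_number (G : sgraph) k :
  b_colorable G k -> k <= b_chromatic_number G.
Proof.
move=> kP; have kG : k < #|G|.+1 by rewrite ltnS b_colorable_leq_card.
exact: (leq_bigmax_cond (F := @nat_of_ord _) (Ordinal kG)).
Qed.

Lemma ordS_neq n (i : 'I_n.+2) : ordS i != i.
Proof.
apply/eqP => /(congr1 val) /=; have := ltn_ord i.
rewrite leq_eqVlt => /predU1P[eq_in|lt_in].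
  by rewrite eq_in modnn; lia.
by rewrite modn_small //; lia.
Qed.

(** * The extremal graph and its parameters *)

Section ExtremalGraph.

Variables m p : nat.

Let t := m.+2.
(** The size c - 1 of the clique of vertices [K l]. *)
Let q := p.+2.

Definition extremal_vertex : finType := ('I_t + 'I_t + 'I_q)%type.

Notation U i := (inl (inl i)).
Notation V i := (inl (inr i)).
Notation K l := (inr l).

Definition VK_adj (j : 'I_t) (l : 'I_q) : bool :=
  if j == 0 :> nat then l != 0 :> nat else (j == 1 :> nat) && (l == 0 :> nat).

Definition extremal_adj (x y : extremal_vertex) : bool :=
  match x, y with
  | U i, V j | V j, U i => i != j
  | U _, K _ | K _, U _ => true
  | V j, K l | K l, V j => VK_adj j l
  | K l, K l' => l != l'
  | _, _ => false
  end.

Lemma extremal_adj_sym : symmetric extremal_adj.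
Proof. by move=> [[i|i]|i] [[j|j]|j] //=; rewrite eq_sym. Qed.

Lemma extremal_adj_irrefl : irreflexive extremal_adj.
Proof. by move=> [[i|i]|i] //=; rewrite eqxx. Qed.

Definition extremal_graph := SGraph extremal_adj_sym extremal_adj_irrefl.

Lemma card_extremal_graph : #|extremal_graph| = t + t + q.
Proof. by rewrite !card_sum !card_ord. Qed.

(** A cover by t cliques: the pairs [V j], [U (j - 1)] with indices taken cyclically, where clique 0
    also receives all [K l] with l nonzero and clique 1 receives [K 0]. *)
Definition clique_index (x : extremal_graph) : 'I_t :=
  match x with
  | U i => ordS i
  | V j => j
  | K l => inord (l == 0 :> nat)
  end.

Lemma clique_indexP x y : clique_index x = clique_index y -> x != y -> adj x y.
Proof.
have VK (j : 'I_t) (l : 'I_q) : j = inord (l == 0 :> nat) -> VK_adj j l.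
  by move=> ->; rewrite /VK_adj inordK; case: (nat_of_ord l).
have UV (i j : 'I_t) : ordS i = j -> i != j.
  by move=> <-; rewrite eq_sym ordS_neq.
move: x y => [[i|i]|i] [[j|j]|j] //=.
- by move/ordS_inj=> ->; rewrite eqxx.
- by move/UV->.
- by move/esym/UV; rewrite eq_sym => ->.
- by move=> ->; rewrite eqxx.
- by move/VK->.
- by move/esym/VK->.
Qed.

Lemma independence_number_extremal : independence_number extremal_graph = t.
Proof.
apply/eqP; rewrite eqn_leq; apply/andP; split.
  by have := independence_number_clique_cover _ _ _ clique_indexP; rewrite card_ord.
pose S : {set extremal_graph} := [set U i | i : 'I_t].
have indS : independent S.
  by apply/independentP=> _ _ /imsetP[i _ ->] /imsetP[j _ ->].
apply: leq_trans (leq_bigmax_cond (F := fun S : {set extremal_graph} => #|S|) S indS).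
by rewrite card_imset ?card_ord // => i j [].
Qed.

Lemma chromatic_number_extremal : chromatic_number extremal_graph = q.+1.
Proof.
apply/eqP; rewrite eqn_leq; apply/andP; split.
  (* The [U i] share a colour of their own, and the [V j] reuse colours of the clique: [V 1] that of
     [K 1], since its only neighbour there is [K 0], and all others that of [K 0], to which they are
     not adjacent. *)
  pose f (x : extremal_graph) : 'I_q.+1 :=
    match x with
    | U _ => ord_max
    | V j => inord (j == 1 :> nat)
    | K l => inord l
    end.
  apply: chromatic_number_leq; apply/existsP; exists (finfun f).
  have fV (b : bool) : (inord b : 'I_q.+1) = b :> nat by rewrite inordK //; case: b.
  have fK (l : 'I_q) : (inord l : 'I_q.+1) = l :> nat.
    by rewrite inordK // ltnW // ltnS ltn_ord.
  have UVcol (b : bool) : ord_max != inord b :> 'I_q.+1.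
    by rewrite -val_eqE /= fV; case: b.
  have UKcol (l : 'I_q) : ord_max != inord l :> 'I_q.+1.
    by rewrite -val_eqE /= fK gtn_eqF.
  have VKcol (j : 'I_t) (l : 'I_q) :
      VK_adj j l -> inord (j == 1 :> nat) != inord l :> 'I_q.+1.
    rewrite /VK_adj -val_eqE /= fV fK.
    by case: (nat_of_ord j) => [|[|]] //=; case: (nat_of_ord l).
  apply/proper_coloringP => -[[i|i]|i] [[j|j]|j] //=; rewrite !ffunE /f //=.
  - by rewrite [_ == ord_max]eq_sym.
  - exact: VKcol.
  - by rewrite eq_sym.
  - by rewrite eq_sym; apply: VKcol.
  - by move=> ij; rewrite -val_eqE /= !fK.
(* All [K l] together with a single [U] vertex form a clique of size [q.+1]. *)
pose g (o : option 'I_q) : extremal_graph := if o is Some l then K l else U ord0.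
have /chromatic_number_clique : forall x y, x != y -> adj (g x) (g y).
  by move=> [l|] [l'|].
by rewrite card_option card_ord.
Qed.

(** Among the 2t + q vertices, [x] misses the t vertices of its own side, itself included, and the
    vertex of equal index on the other side. *)
Lemma degree_UV (x : 'I_t + 'I_t) : #|@adj extremal_graph (inl x)| < t + q.
Proof.
(* Here [c] embeds the side of [y] and [c'] the opposite side, which treats both sides at once. *)
have nadjP (i0 : 'I_t) (c c' : 'I_t -> 'I_t + 'I_t) (y := inl (c i0)) :
    injective c -> (forall i j, c i != c' j) ->
    (forall i, ~~ extremal_adj y (inl (c i))) ->
    ~~ extremal_adj y (inl (c' i0)) ->
  #|@adj extremal_graph y| < t + q.
  move=> c_inj cc' ycP yc'.
  pose N : {set extremal_graph} := inl (c' i0) |: [set inl (c i) | i : 'I_t].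
  have cardN : #|N| = t.+1.
    rewrite cardsU1 card_imset ?card_ord; last by move=> i j [] /c_inj.
    case: imsetP => // -[i _ [] /esym/eqP]; by rewrite (negPf (cc' _ _)).
  have /subset_leq_card : @adj extremal_graph y \subset ~: N.
    apply/subsetP=> z; rewrite !inE; apply: contraL => /predU1P[->//|].
    by case/imsetP=> i _ ->; apply: ycP.
  by rewrite cardsCs setCK cardN card_extremal_graph /t; lia.
case: x => i.
- by apply: (nadjP i inl inr) => //= [? ? []|] //; rewrite eqxx.
- by apply: (nadjP i inr inl) => //= [? ? []|] //; rewrite eqxx.
Qed.

Lemma b_chromatic_number_extremal : b_chromatic_number extremal_graph = t + q.
Proof.
apply/eqP; rewrite eqn_leq; apply/andP; split.
  apply/bigmax_leqP=> k /b_colorable_degree kP; rewrite leqNgt; apply/negP=> lt_k.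
  move: kP; apply/negP; rewrite -ltnNge; apply: leq_ltn_trans (lt_k).
  apply: leq_trans (leq_addl t q).
  (* With k > t + q colours only the [K l] have sufficient degree, and there are just [q] of
     them. *)
  have <- : #|[set: 'I_q]| = q by rewrite cardsT card_ord.
  apply: leq_trans (leq_imset_card (fun l : 'I_q => K l : extremal_graph) _).
  apply/subset_leq_card/subsetP => -[x|l] //; rewrite inE.
    by move=> kx; have := leq_trans lt_k kx; rewrite ltnS leqNgt degree_UV.
  by move=> _; apply: imset_f.
pose f (x : extremal_graph) : 'I_(t + q) :=
  match x with
  | U i | V i => lshift q i
  | K l => rshift t l
  end.
apply: leq_b_chromatic_number; apply/existsP; exists (finfun f); apply/andP; split.
  apply/proper_coloringP => -[[i|i]|i] [[j|j]|j] //=; rewrite !ffunE //=;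
    by rewrite ?eq_lshift ?eq_rshift ?eq_lrshift ?eq_rlshift // eq_sym.
apply/forallP=> j; apply/existsP; case: (split_ordP j) => [i ->|l ->].
(* The b-vertices are the [U i] and the [K l]; [U i] sees the colour of another [U i'] through
   [V i']. *)
- exists (U i); rewrite ffunE eqxx /=; apply/forallP=> j'; rewrite ffunE.
  apply/implyP; case: (split_ordP j') => [i' ->|l' ->] /= ne; apply/existsP.
    by exists (V i'); rewrite ffunE eqxx /= andbT eq_sym -(eq_lshift q).
  by exists (K l'); rewrite ffunE /=.
- exists (K l); rewrite ffunE eqxx /=; apply/forallP=> j'; rewrite ffunE.
  apply/implyP; case: (split_ordP j') => [i' ->|l' ->] /= ne; apply/existsP.
    by exists (U i'); rewrite ffunE /=.
  by exists (K l'); rewrite ffunE eqxx /= andbT eq_sym -(eq_rshift t).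
Qed.

End ExtremalGraph.

Import GRing.Theory.
Local Open Scope ring_scope.

Theorem proposition3 (t c : nat) (ht : (2 <= t)%N) (hc : (3 <= c)%N) :
  exists G : sgraph,
    [/\ independence_number G = t,
        chromatic_number G = c
      & (b_chromatic_number G)%:R =
        ((t%:R - 1) * #|G|%:R + t%:R * (chromatic_number G)%:R)
          / (2 * t%:R - 1) :> rat].
Proof.
case: t ht => [|[|m]] // _; case: c hc => [|[|[|p]]] // _.
exists (extremal_graph m p); split.
- exact: independence_number_extremal.
- exact: chromatic_number_extremal.
rewrite b_chromatic_number_extremal chromatic_number_extremal card_extremal_graph.
have nz : 2 * m.+2%:R - 1 != 0 :> rat.
  by rewrite subr_eq0 -natrM (Num.Theory.eqr_nat _ _ 1) mulnS.
(* With |G| = 2t + c - 1, this is (t + c - 1)(2t - 1) = (t - 1)(2t + c - 1) + tc. *)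
apply: (canRL (mulfK nz)); rewrite !natrD -[p.+3]addn1 natrD; ring.
Qed.
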